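(* Let $S$ be a stratum with $\sigma_S^2>0$. Then for any $\theta\in[0,1]$ the probability of underestimating the local variance of $Q_S$ by the factor $\theta$ is bounded by $$\mathbb{P}(\hat{\sigma}_S^2 \le \theta \sigma_S^2) \le 1- \frac{(1-\theta)^2}{(1-\theta)^2 + N_{S}^{-1}\left( \kappa_S - \frac{N_{S}-3}{N_{S}-1}\right)} = \frac{\kappa_S - \frac{N_{S}-3}{N_{S}-1}}{N_{S} (1-\theta)^2 + \left( \kappa_S - \frac{N_{S}-3}{N_{S}-1}\right)},$$ where $\kappa_S$ denotes the kurtosis of $Q_S$.
   Context: Let $\mathbf{Y}$ be uniformly distributed on $[0,1]^n$, $f\colon\mathbb{R}^n\to\mathbb{R}$ measurable, and $S\subset[0,1]^n$ a measurable set (stratum) of positive measure. $Q_S$ is a real random variable having the conditional distribution of $f(\mathbf{Y})$ given $\mathbf{Y}\in S$, assumed to have finite fourth moment; $\sigma_S^2=\mathrm{Var}(Q_S)$ and $\kappa_S=\mathbb{E}(|Q_S-\mathbb{E}(Q_S)|^4)/\sigma_S^4$. For a fixed integer $N_S\ge2$ and i.i.d. samples $Q_S^{(1)},\dots,Q_S^{(N_S)}$ of $Q_S$, the empirical variance is $\hat\sigma_S^2=\frac1{N_S-1}\sum_{j=1}^{N_S}(Q_S^{(j)}-\overline{Q}_S)^2$ with $\overline{Q}_S=\frac1{N_S}\sum_{j=1}^{N_S}Q_S^{(j)}$. *)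

(* Defs.v *)
From HB Require Import structures.
From mathcomp Require Import all_boot all_order all_algebra.
From mathcomp Require Import all_classical all_reals all_analysis.

Set Implicit Arguments.
Unset Strict Implicit.
Unset Printing Implicit Defensive.

Import Order.TTheory GRing.Theory Num.Theory.
Import numFieldNormedType.Exports.

Local Open Scope classical_set_scope.
Local Open Scope ring_scope.

(* R^n is [n.-tuple R] with the product of the Borel sigma-algebras, which is
   the Borel sigma-algebra of R^n.  Its Lebesgue measure is obtained by
   recursion on n, as the image of [lebesgue_measure \x lambda^n] under the
   bijection R * R^n -> R^(n+1), (x, t) |-> x :: t. *)
Section lebesgue_measure_cons.
Context (R : realType) (n : nat).
Variable m : {sigma_finite_measure set (n.-tuple R) -> \bar R}.

Let consp (p : measurableTypeR R * n.-tuple R) : n.+1.-tuple R :=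
  [tuple of p.1 :: p.2].
Let unconsp (t : n.+1.-tuple R) : measurableTypeR R * n.-tuple R :=
  (thead t, [tuple of behead t]).

Definition lebesgue_measure_cons : set (n.+1.-tuple R) -> \bar R :=
  pushforward (@lebesgue_measure R \x m)%E consp.

Let mconsp : measurable_fun setT consp.
Proof.
by apply: (@measurable_cons _ _ (measurableTypeR R * n.-tuple R)%type R fst n snd).
Qed.

Let munconsp : measurable_fun setT unconsp.
Proof.
apply: measurable_fun_pair; last exact: measurable_behead.
exact: (measurable_tnth ord0).
Qed.

Let lebesgue_measure_cons0 : lebesgue_measure_cons set0 = 0%E.
Proof. by rewrite /lebesgue_measure_cons /pushforward preimage_set0 measure0. Qed.

Let lebesgue_measure_cons_ge0 A : (0 <= lebesgue_measure_cons A)%E.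
Proof. exact: measure_ge0. Qed.

Let lebesgue_measure_cons_sigma_additive :
  semi_sigma_additive lebesgue_measure_cons.
Proof.
move=> F mF tF mUF; rewrite /lebesgue_measure_cons /pushforward preimage_bigcup.
apply: measure_semi_sigma_additive.
- by move=> k; rewrite -[X in measurable X]setTI; exact: mconsp.
- apply/trivIsetP => /= i j _ _ ij; rewrite -preimage_setI.
  by move/trivIsetP : tF => /(_ _ _ _ _ ij) ->//; rewrite preimage_set0.
- by rewrite -preimage_bigcup -[X in measurable X]setTI; exact: mconsp.
Qed.

HB.instance Definition _ := isMeasure.Build _ _ _ lebesgue_measure_cons
  lebesgue_measure_cons0 lebesgue_measure_cons_ge0
  lebesgue_measure_cons_sigma_additive.

Let unconspK p : unconsp (consp p) = p.
Proof.
by case: p => x t; rewrite /unconsp /consp theadE; congr (_, _); exact/val_inj.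
Qed.

Let lebesgue_measure_cons_sigma_finite : sigma_finite setT lebesgue_measure_cons.
Proof.
have /sigma_finiteP[F [FT ndF Foo]] := sigma_finiteT (@lebesgue_measure R).
have /sigma_finiteP[G [GT ndG Goo]] := sigma_finiteT m.
exists (fun k => unconsp @^-1` (F k `*` G k)).
  rewrite -preimage_bigcup -[LHS](@preimage_setT _ _ unconsp); congr (_ @^-1` _).
  rewrite -setXTT FT GT; apply/seteqP; split=> -[x y].
    move=> [/= [i _ Fix] [j _ Gjy]]; exists (maxn i j) => //; split.
      by move: x Fix; exact/subsetPset/ndF/leq_maxl.
    by move: y Gjy; exact/subsetPset/ndG/leq_maxr.
  by move=> [k _ [/= ? ?]]; split; exists k.
move=> k; have [mFk Fk] := Foo k; have [mGk Gk] := Goo k; split.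
  by rewrite -[X in measurable X]setTI; apply: munconsp => //; exact: measurableX.
rewrite /lebesgue_measure_cons /pushforward -comp_preimage.
rewrite (_ : unconsp \o consp = id); last by apply/funext => p /=; rewrite unconspK.
by rewrite preimage_id product_measure1E// lte_mul_pinfty// ge0_fin_numE.
Qed.

HB.instance Definition _ := Measure_isSigmaFinite.Build _ _ _
  lebesgue_measure_cons lebesgue_measure_cons_sigma_finite.

End lebesgue_measure_cons.

Fixpoint lebesgue_measure_tuple (R : realType) (n : nat) :
    {sigma_finite_measure set (n.-tuple R) -> \bar R} :=
  if n is n'.+1 then lebesgue_measure_cons (lebesgue_measure_tuple R n')
  else \d_ [tuple].

Definition unit_cube (R : realType) (n : nat) : set (n.-tuple R) :=
  [set t | forall i, 0 <= tnth t i <= 1].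
Arguments unit_cube : clear implicits.

(* The intended use has 0 < lambda D < +oo. *)
Definition uniform_on (R : realType) (n : nat) (D : set (n.-tuple R))
    (d : measure_display) (Omega : measurableType d) (P : probability Omega R)
    (Y : {RV P >-> n.-tuple R}) : Prop :=
  forall A : set (n.-tuple R), measurable A ->
    (distribution P Y A
     = lebesgue_measure_tuple R n (A `&` D) / lebesgue_measure_tuple R n D)%E.

Definition cond_prob (R : realType) (d : measure_display)
    (Omega : measurableType d) (P : probability Omega R) (A B : set Omega)
    : \bar R :=
  (P (A `&` B) / P B)%E.

Definition has_cond_distribution (R : realType) (n : nat)
    (d : measure_display) (Omega : measurableType d) (P : probability Omega R)
    (Y : {RV P >-> n.-tuple R}) (f : n.-tuple R -> R) (S : set (n.-tuple R))
    (d' : measure_display) (Omega' : measurableType d')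
    (P' : probability Omega' R) (Q : {RV P' >-> R}) : Prop :=
  forall B : set R, measurable B ->
    distribution P' Q B = cond_prob P ((f \o Y) @^-1` B) (Y @^-1` S).

Definition mutually_independent (R : realType) (d : measure_display)
    (Omega : measurableType d) (P : probability Omega R) (I : finType)
    (X : I -> {RV P >-> R}) : Prop :=
  forall (J : {set I}) (B : I -> set R), (forall i, measurable (B i)) ->
    P (\bigcap_(i in [set` J]) (X i @^-1` B i))
    = (\prod_(i in J) P (X i @^-1` B i))%E.

Definition iid_samples (R : realType) (d : measure_display)
    (Omega : measurableType d) (P : probability Omega R) (N : nat)
    (Q : {RV P >-> R}) (X : 'I_N -> {RV P >-> R}) : Prop :=
  mutually_independent X /\
  forall (j : 'I_N) (B : set R), measurable B ->
    distribution P (X j) B = distribution P Q B.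

Definition kurtosis (R : realType) (d : measure_display)
    (Omega : measurableType d) (P : probability Omega R) (X : {RV P >-> R})
    : R :=
  fine 'E_P[fun w => `|X w - fine 'E_P[X]| ^+ 4] / (fine 'V_P[X]) ^+ 2.

Definition sample_mean (R : realType) (T : Type) (N : nat)
    (X : 'I_N -> T -> R) (w : T) : R :=
  N%:R^-1 * \sum_(j < N) X j w.

Definition empirical_variance (R : realType) (T : Type) (N : nat)
    (X : 'I_N -> T -> R) (w : T) : R :=
  (N%:R - 1)^-1 * \sum_(j < N) (X j w - sample_mean X w) ^+ 2.

(* Main.v *)
Require Import Defs.
From HB Require Import structures.
From mathcomp Require Import all_boot all_order all_algebra.
From mathcomp Require Import all_classical all_reals all_analysis.
From mathcomp Require Import measurable_realfun ring lra.

Set Implicit Arguments.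
Unset Strict Implicit.
Unset Printing Implicit Defensive.

Import Order.TTheory GRing.Theory Num.Theory.
Import numFieldNormedType.Exports.

Local Open Scope classical_set_scope.
Local Open Scope ring_scope.

(** The empirical variance S of the sample is an unbiased estimator of the
    variance v of Q, so that underestimating v by the factor theta < 1 is a
    deviation of S below its mean by at least (1 - theta) v, which Cantelli's
    one-sided inequality ([cantelli_lower_tail]) bounds by
    V / (V + (1 - theta) ^+ 2 v ^+ 2), with V the variance of S.  It remains to
    show that V = v ^+ 2 / N (kurtosis - (N - 3) / (N - 1))
    ([variance_empirical_variance]).

    To this end S is written as a quadratic form in the centered observations
    Z i = X i - 'E[Q] ([empirical_varianceE]).  Its second moment is a
    combination of the expectations of Z i Z j Z k Z l, which vanish unless the
    indices match in pairs ([Rintegral_monomial4]); summing the three pairings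
    gives the second moment of any quadratic form in independent centered
    variables with the same second and fourth moments
    ([Rintegral_quadratic_form_sqr]).

    The expectations of monomials rest on the product rule for independent
    variables ([Rintegral_prod_comp]), derived from the product rule for events
    by replacing indicators by measurable functions one index at a time
    ([ge0_integral_comp_mul]). *)

(** * Linearity of the real-valued integral *)

Lemma Rintegral_sum d (T : measurableType d) (R : realType)
    (mu : {measure set T -> \bar R}) (I : Type) (s : seq I) (F : I -> T -> R)
    (iF : forall i, mu.-integrable setT (fun w => (F i w)%:E)) :
  \int[mu]_w (\sum_(i <- s) F i w) = \sum_(i <- s) \int[mu]_w F i w.
Proof.
elim: s => [|i s IH].
  under eq_Rintegral do rewrite big_nil; rewrite big_nil /Rintegral integral0//.
under eq_Rintegral do rewrite big_cons.
rewrite big_cons RintegralD ?IH//; first exact: iF.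
have := @integrable_sum _ _ _ mu setT measurableT _ s xpredT _
  (fun i _ => iF i).
by apply: eq_integrable => // w _; rewrite /= sumEFin.
Qed.

Lemma Rintegral_probability_cst d (T : measurableType d) (R : realType)
    (P : probability T R) (r : R) : \int[P]_w (cst r w) = r.
Proof. by rewrite Rintegral_cst// [X in _ * fine X]probability_setT mulr1. Qed.

Lemma integrable_scale d (T : measurableType d) (R : realType)
    (mu : {measure set T -> \bar R}) (k : R) (f : T -> R) :
    mu.-integrable setT (fun w => (f w)%:E) ->
  mu.-integrable setT (fun w => (k * f w)%:E).
Proof. by move=> intf; exact: (integrableZl measurableT k intf). Qed.

(** * Product rule for independent random variables *)

Section factor_rule.
Local Open Scope ereal_scope.
Context d d' (T : measurableType d) (T' : measurableType d') (R : realType).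
Variable P : {measure set T -> \bar R}.

Import HBNNSimple.

(** By linearity and monotone convergence, both sides are determined by the
    indicators g = \1_B.  This is the step that turns an independence statement
    about events into one about integrals, one variable at a time. *)
Lemma ge0_integral_comp_mul (X : {mfun T >-> T'}) (G : T -> R) (c : R)
    (mG : measurable_fun setT G) (G0 : forall w, (0 <= G w)%R) (c0 : (0 <= c)%R)
    (GX : forall B : set T', measurable B ->
      \int[P]_w (\1_B (X w) * G w)%:E = P (X @^-1` B) * c%:E)
    (g : T' -> R) (mg : measurable_fun setT g) (g0 : forall x, (0 <= g x)%R) :
  \int[P]_w (g (X w) * G w)%:E = (\int[P]_w (g (X w))%:E) * c%:E.
Proof.
have mGE : measurable_fun setT (fun w => (G w)%:E) by exact/measurable_EFinP.
have mgE : measurable_fun setT (fun x => (g x)%:E) by exact/measurable_EFinP.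
(* Both sides are sums over the level sets of h, where GX applies. *)
have simple (h : {nnsfun T' >-> R}) :
    \int[P]_w ((h (X w))%:E * (G w)%:E) = \int[P]_w ((h (X w))%:E * c%:E).
  have mXh r : measurable (X @^-1` (h @^-1` [set r])).
    by rewrite -[X in measurable X]setTI; exact: measurable_funPT.
  have mB r : measurable_fun setT
      (fun w => (\1_(h @^-1` [set r]) (X w))%:E : \bar R).
    by apply/measurable_EFinP; exact: (measurable_indic (mXh r)).
  have hX w : (h (X w))%:E =
      \sum_(r \in range h) (r%:E * (\1_(h @^-1` [set r]) (X w))%:E).
    by rewrite [in LHS]fimfunE -fsumEFin.
  have expand (F : T -> \bar R) : measurable_fun setT F ->
      (forall w, 0 <= F w) ->
      \int[P]_w ((h (X w))%:E * F w) = \sum_(r \in range h)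
        (r%:E * \int[P]_w ((\1_(h @^-1` [set r]) (X w))%:E * F w)).
    move=> mF F0.
    under eq_integral => w _.
      rewrite hX ge0_mule_fsuml; last first.
        by move=> r; rewrite -EFinM nnfun_muleindic_ge0.
      over.
    rewrite ge0_integral_fsum//; last 2 first.
    - move=> r; apply: emeasurable_funM => //.
      exact: measurable_funeM.
    - by move=> r w _; rewrite mule_ge0// -EFinM nnfun_muleindic_ge0.
    apply: eq_fsbigr => r /[!inE] -[x _ <-].
    under eq_integral do rewrite -muleA.
    rewrite ge0_integralZl//.
    - by apply: emeasurable_funM.
    - by move=> w _; rewrite mule_ge0// lee_fin.
    - by rewrite lee_fin.
  rewrite expand// expand//.
  apply: eq_fsbigr => r _; congr (_ * _).
  under eq_integral do rewrite -EFinM.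
  rewrite GX// ge0_integralZr//.
  congr (_ * _).
  rewrite -[RHS]/(\int[P]_w (\1_(X @^-1` (h @^-1` [set r])) w)%:E).
  by rewrite integral_indic ?setIT.
pose h := nnsfun_approx measurableT mgE.
have lim_h (F : T -> R) : measurable_fun setT F -> (forall w, (0 <= F w)%R) ->
    \int[P]_w ((g (X w))%:E * (F w)%:E)
    = limn (fun n => \int[P]_w ((h n (X w))%:E * (F w)%:E)).
  move=> mF F0; rewrite -monotone_convergence//.
  - apply: eq_integral => w _; apply/esym/cvg_lim => //.
    apply: cvgeZr => //.
    apply: (cvg_nnsfun_approx measurableT mgE) => //.
    by move=> x _; rewrite lee_fin.
  - move=> n; apply: emeasurable_funM; apply/measurable_EFinP => //.
    exact: measurableT_comp.
  - by move=> n w _; rewrite mule_ge0// lee_fin.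
  - move=> w _ m n mn; rewrite lee_wpmul2r// lee_fin//.
    exact/lefP/nd_nnsfun_approx.
rewrite -ge0_integralZr//; first last.
- by move=> w _; rewrite lee_fin.
- by apply/measurable_EFinP; exact: measurableT_comp.
under eq_integral do rewrite EFinM.
rewrite (lim_h G)// -[RHS]/(\int[P]_w ((g (X w))%:E * ((fun=> c) w)%:E)).
rewrite (lim_h (fun=> c))//.
by under eq_fun do rewrite simple.
Qed.

End factor_rule.

Section independent_product.
Context (R : realType) d (T : measurableType d) (P : probability T R).
Context (I : finType) (X : I -> {RV P >-> R}).
Hypothesis indX : mutually_independent X.

(** Independence is the case where every g i is an indicator; the general case
    replaces the indicators by arbitrary functions one index at a time. *)
Lemma ge0_integral_prod_comp (g : I -> R -> R)
    (mg : forall i, measurable_fun setT (g i)) (g0 : forall i x, 0 <= g i x)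
    (gfin : forall i, (\int[P]_w (g i (X i w))%:E < +oo)%E) :
  (\int[P]_w (\prod_i g i (X i w))%:E = \prod_i \int[P]_w (g i (X i w))%:E)%E.
Proof.
have mpre i B : measurable B -> measurable (X i @^-1` B).
  by move=> mB; rewrite -[X in measurable X]setTI; exact: measurable_funPT.
have int1 i B : measurable B ->
    (\int[P]_w (\1_B (X i w))%:E = P (X i @^-1` B))%E.
  move=> mB; rewrite -[LHS]/(\int[P]_w (\1_(X i @^-1` B) w)%:E)%E.
  by rewrite integral_indic ?setIT//; exact: mpre.
have gfinE (g' : I -> R -> R) : (forall i x, 0 <= g' i x) ->
    (forall i, (\int[P]_w (g' i (X i w))%:E < +oo)%E) ->
    forall i, (\int[P]_w (g' i (X i w))%:E)%E \is a fin_num.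
  move=> g'0 g'fin i; rewrite ge0_fin_numE//.
  by apply: integral_ge0 => w _; rewrite lee_fin.
(* The list s holds the indices at which g need not be an indicator. *)
suff indics (s : seq I) : forall g : I -> R -> R,
    (forall i, measurable_fun setT (g i)) -> (forall i x, 0 <= g i x) ->
    (forall i, (\int[P]_w (g i (X i w))%:E < +oo)%E) ->
    (forall i, i \notin s -> exists2 B : set R, measurable B & g i = \1_B) ->
    (\int[P]_w (\prod_i g i (X i w))%:E = \prod_i \int[P]_w (g i (X i w))%:E)%E.
  by apply: (indics (enum I)) => // i; rewrite mem_enum.
elim: s => [|a s IH] {mg g0 gfin}g mg g0 gfin gs.
  have {gs} /choice[B gB] : forall i,
      exists B : set R, measurable B /\ g i = \1_B.
    by move=> i; have [//|B mB gB] := gs i; exists B.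
  have indE w : \prod_i g i (X i w) =
      \1_(\bigcap_(i in [set` [set: I]%SET]) (X i @^-1` B i)) w.
    rewrite indicE; have [/set_mem/= wB|/negP wB] := boolP (_ \in _).
      rewrite big1// => i _; rewrite (gB i).2 indicE mem_set//.
      by apply: wB; rewrite /= finset.in_setT.
    have [/= i wBi] : exists i, ~ B i (X i w).
      apply/existsNP => wB'; apply: wB; apply/mem_set => i _; exact: wB'.
    by rewrite (bigD1 i)//= (gB i).2 indicE memNset// mul0r.
  under eq_integral do rewrite indE.
  rewrite integral_indic//; last first.
    by apply: fin_bigcap_measurable => // i _; apply: mpre; exact: (gB i).1.
  rewrite setIT [LHS](indX [set: I]%SET (fun i => (gB i).1)).
  apply: eq_big => [i|i _]; first by rewrite finset.in_setT.
  by rewrite (gB i).2 int1//; exact: (gB i).1.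
pose G w := \prod_(i | i != a) g i (X i w).
have cfin : (\prod_(i | i != a) \int[P]_w (g i (X i w))%:E)%E \is a fin_num.
  by apply: (big_ind (fun x => x \is a fin_num)) => // [x y|i _];
    [exact: fin_numM|exact: gfinE].
transitivity (\int[P]_w (g a (X a w) * G w)%:E)%E.
  by apply: eq_integral => w _; rewrite (bigD1 a).
rewrite (bigD1 a)//= -[X in (_ * X)%E](fineK cfin).
apply: ge0_integral_comp_mul => //.
- rewrite /G; under eq_fun do rewrite -big_filter.
  by apply: measurable_prod => i _; exact: measurableT_comp.
- by move=> w; apply: prodr_ge0.
- apply/fine_ge0/prode_ge0 => i _; apply: integral_ge0 => w _.
  by rewrite lee_fin.
move=> B mB; rewrite fineK//.
pose g' i := if i == a then \1_B else g i.
have g'a : g' a = \1_B by rewrite /g' eqxx.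
have g'N i : i != a -> g' i = g i by rewrite /g' => /negbTE ->.
transitivity (\int[P]_w (\prod_i g' i (X i w))%:E)%E.
  apply: eq_integral => w _; rewrite (bigD1 a)//= g'a; congr (_ * _)%:E.
  by apply: eq_bigr => i ia; rewrite g'N.
rewrite IH.
- rewrite (bigD1 a)//= g'a int1//; congr (_ * _)%E.
  by apply: eq_bigr => i ia; rewrite g'N.
- by move=> i; rewrite /g'; case: ifP.
- by move=> i x; rewrite /g'; case: ifP.
- move=> i; rewrite /g'; case: ifP => // _; rewrite int1//.
  by rewrite (le_lt_trans (probability_le1 _ _)) ?ltry//; exact: mpre.
- move=> i is_; rewrite /g'; case: ifPn => [_|ia]; first by exists B.
  by apply: gs; rewrite inE negb_or ia.
Qed.

Lemma ge0_Rintegral_prod_comp (g : I -> R -> R)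
    (mg : forall i, measurable_fun setT (g i)) (g0 : forall i x, 0 <= g i x)
    (ig : forall i, P.-integrable setT (fun w => (g i (X i w))%:E)) :
  \int[P]_w (\prod_i g i (X i w)) = \prod_i \int[P]_w (g i (X i w)).
Proof.
apply: EFin_inj; rewrite -prodEFin.
transitivity (\prod_i \int[P]_w (g i (X i w))%:E)%E; last first.
  by apply: eq_bigr => i _; rewrite fineK// integrable_fin_num.
have ltoo i : (\int[P]_w (g i (X i w))%:E < +oo)%E.
  by rewrite ltey_eq integrable_fin_num.
rewrite -ge0_integral_prod_comp// fineK// ge0_integral_prod_comp//.
by apply: (big_ind (fun x => x \is a fin_num)) => // [x y|i _];
  [exact: fin_numM|exact: integrable_fin_num].
Qed.

Lemma integrable_prod_comp (g : I -> R -> R)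
    (mg : forall i, measurable_fun setT (g i))
    (ig : forall i, P.-integrable setT (fun w => (g i (X i w))%:E)) :
  P.-integrable setT (fun w => (\prod_i g i (X i w))%:E).
Proof.
have mgX i : measurable_fun setT (fun w => g i (X i w)).
  exact: measurableT_comp.
apply/integrableP; split.
  by apply/measurable_EFinP; apply: measurable_prod => i _.
under eq_integral do rewrite /= normr_prod.
rewrite (ge0_integral_prod_comp (g := fun i x => `|g i x|)) => //.
- rewrite ltey_eq; apply/orP; left.
  apply: (big_ind (fun x => x \is a fin_num)) => // [x y|i _].
    exact: fin_numM.
  apply: integrable_fin_num => //.
  exact: (integrable_abse (ig i)).
- by move=> i; exact: measurableT_comp.
- by move=> i; have /integrableP[] := ig i.
Qed.

(** Each g i is the difference of its positive and negative parts; expanding the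
    product gives a signed sum of products of nonnegative functions. *)
Lemma Rintegral_prod_comp (g : I -> R -> R)
    (mg : forall i, measurable_fun setT (g i))
    (ig : forall i, P.-integrable setT (fun w => (g i (X i w))%:E)) :
  \int[P]_w (\prod_i g i (X i w)) = \prod_i \int[P]_w (g i (X i w)).
Proof.
pose F i (b : bool) : R -> R := if b then (g i)^\- else (g i)^\+.
have gF i x : g i x = \sum_(b : bool) (-1) ^+ b * F i b x.
  rewrite big_bool/= expr0 expr1 mul1r mulN1r addrC.
  by rewrite -[in LHS](funrposBneg (g i)).
have mF i b : measurable_fun setT (F i b).
  by case: b; [exact: measurable_funrneg|exact: measurable_funrpos].
have F0 i b x : 0 <= F i b x.
  by case: b; [exact: funrneg_ge0|exact: funrpos_ge0].
have iF i b : P.-integrable setT (fun w => (F i b (X i w))%:E).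
  case: b; [exact: (integrable_funrneg measurableT (ig i))|].
  exact: (integrable_funrpos measurableT (ig i)).
under eq_Rintegral => w _.
  under eq_bigr do rewrite gF.
  rewrite bigA_distr_bigA/=.
  under eq_bigr do rewrite big_split/=.
  over.
rewrite Rintegral_sum; last first.
  move=> f; apply: integrable_scale.
  exact: (integrable_prod_comp (g := fun i => F i (f i))).
have intg i : \int[P]_w g i (X i w) =
    \sum_(b : bool) (-1) ^+ b * \int[P]_w F i b (X i w).
  under eq_Rintegral do rewrite gF.
  rewrite Rintegral_sum; last by move=> b; exact: integrable_scale.
  by apply: eq_bigr => b _; rewrite RintegralZl//; exact: iF.
under [RHS]eq_bigr do rewrite intg.
rewrite bigA_distr_bigA/=; apply: eq_bigr => f _.
rewrite big_split/= RintegralZl//; last first.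
  exact: (integrable_prod_comp (g := fun i => F i (f i))).
by rewrite (ge0_Rintegral_prod_comp (g := fun i => F i (f i))).
Qed.

End independent_product.

(** * Moments of quadratic forms in independent centered variables *)

Section centered_moments.
Context (R : realType) d (T : measurableType d) (P : probability T R).
Context (I : finType) (X : I -> {RV P >-> R}).
Hypothesis indX : mutually_independent X.
Context (m v q : R).
Hypothesis iX : forall i k, (k <= 4)%N ->
  P.-integrable setT (fun w => ((X i w - m) ^+ k)%:E).
Hypothesis EX1 : forall i, \int[P]_w (X i w - m) = 0.
Hypothesis EX2 : forall i, \int[P]_w ((X i w - m) ^+ 2) = v.
Hypothesis EX4 : forall i, \int[P]_w ((X i w - m) ^+ 4) = q.

Local Notation Z i w := (X i w - m).

Let pow k (x : R) := (x - m) ^+ k.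

Let measurable_pow k : measurable_fun setT (pow k).
Proof. by apply: measurable_funX; exact: measurable_funB. Qed.

Let prod_count (s : seq I) w :
  \prod_(j <- s) Z j w = \prod_i pow (count_mem i s) (X i w).
Proof.
elim: s => [|j s IH]; first by rewrite big_nil big1.
rewrite big_cons IH.
rewrite (bigD1 j)//= [RHS](bigD1 j)//= eqxx /pow exprS -mulrA.
by congr (_ * (_ * _)); apply: eq_bigr => i ij; rewrite eq_sym (negbTE ij).
Qed.

Lemma integrable_monomial (s : seq I) : (size s <= 4)%N ->
  P.-integrable setT (fun w => (\prod_(j <- s) Z j w)%:E).
Proof.
move=> s4; under eq_fun do rewrite prod_count.
apply: (integrable_prod_comp indX (g := fun i => pow (count_mem i s))) => // i.
by apply: iX; exact: leq_trans (count_size _ _) s4.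
Qed.

(** Grouping equal indices turns the monomial into a product of functions of
    distinct, hence independent, variables. *)
Lemma Rintegral_monomial (s : seq I) : (size s <= 4)%N ->
  \int[P]_w (\prod_(j <- s) Z j w) =
  \prod_i \int[P]_w ((X i w - m) ^+ count_mem i s).
Proof.
move=> s4; under eq_Rintegral do rewrite prod_count.
rewrite (Rintegral_prod_comp indX (g := fun i => pow (count_mem i s)))// => i.
by apply: iX; exact: leq_trans (count_size _ _) s4.
Qed.

Let EX0 i : \int[P]_w ((X i w - m) ^+ 0) = 1.
Proof.
under eq_Rintegral do rewrite expr0.
exact: Rintegral_probability_cst.
Qed.

Lemma Rintegral_monomial_single (s : seq I) i : (size s <= 4)%N ->
  count_mem i s = 1%N -> \int[P]_w (\prod_(j <- s) Z j w) = 0.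
Proof.
by move=> s4 is1; rewrite Rintegral_monomial// (bigD1 i)//= is1 EX1 mul0r.
Qed.

Lemma Rintegral_monomial2 i j :
  \int[P]_w (Z i w * Z j w) = v * (i == j)%:R.
Proof.
transitivity (\int[P]_w (\prod_(k <- [:: i; j]) Z k w)).
  by apply: eq_Rintegral => w _; rewrite !big_cons big_nil mulr1.
have [<-|ij] := eqVneq i j; last first.
  by rewrite (@Rintegral_monomial_single _ i) ?mulr0//= eqxx eq_sym (negbTE ij).
rewrite Rintegral_monomial// (bigD1 i)//= eqxx EX2 big1 ?mulr1// => k ki.
by rewrite eq_sym (negbTE ki).
Qed.

(** The expectation vanishes unless the indices match in pairs.  Each of the
    three pairings contributes v ^+ 2; when all indices agree the three of them
    are counted, whereas the value is q, which explains the last term. *)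
Lemma Rintegral_monomial4 i j k l :
  \int[P]_w (Z i w * Z j w * (Z k w * Z l w)) =
  v ^+ 2 * (((i == j) && (k == l))%:R + ((i == k) && (j == l))%:R
            + ((i == l) && (j == k))%:R)
  + (q - 3 * v ^+ 2) * [&& i == j, i == k & i == l]%:R.
Proof.
pose E s := \int[P]_w (\prod_(n <- s) Z n w).
transitivity (E [:: i; j; k; l]).
  by apply: eq_Rintegral => w _; rewrite !big_cons big_nil mulr1 !mulrA.
have pair a b s : a != b -> perm_eq s [:: a; a; b; b] -> E s = v ^+ 2.
  move=> ab sab; transitivity (E [:: a; a; b; b]).
    by apply: eq_Rintegral => w _; exact: perm_big.
  rewrite /E Rintegral_monomial// (bigD1 a)//= (bigD1 b)/=; last first.
    by rewrite eq_sym.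
  rewrite !eqxx (negbTE ab) eq_sym (negbTE ab)/= !EX2 big1 ?mulr1 ?expr2// => c.
  by move=> /andP[ca cb]; rewrite !(eq_sym _ c) (negbTE ca) (negbTE cb).
have single a s : (size s <= 4)%N -> count_mem a s = 1%N -> E s = 0.
  exact: Rintegral_monomial_single.
have neq (a b : I) : a != b -> ((a == b) = false) * ((b == a) = false).
  by move=> ab; rewrite [b == a]eq_sym (negbTE ab).
have [<-|/neq ij] := eqVneq i j.
  have [<-|/neq kl] := eqVneq k l.
    have [<-|/[dup] ik' /neq ik] := eqVneq i k.
      rewrite /E Rintegral_monomial// (bigD1 i)//= eqxx EX4 big1 => [|c ci].
        by rewrite /=; ring.
      by rewrite eq_sym (negbTE ci).
    by rewrite (pair i k)//=; ring.
  have [ik|/neq ik] := eqVneq i k.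
    subst k.
    rewrite (single l) ?kl//=; last by rewrite !kl eqxx.
    by ring.
  rewrite (single k)//= ?ik ?kl ?eqxx//= ?andbF/=.
  by ring.
have [<-|/neq ik] := eqVneq i k.
  have [<-|/neq jl] := eqVneq j l.
    rewrite (pair i j) ?ij//=; last first.
      by apply/permP => a /=; ring.
    by rewrite ?ij//=; ring.
  rewrite (single j)//= ?ij ?jl ?eqxx//= ?andbF/=.
  by ring.
have [<-|/neq il] := eqVneq i l.
  have [<-|/neq jk] := eqVneq j k.
    rewrite (pair i j) ?ij//=; last first.
      by apply/permP => a /=; ring.
    by rewrite ?ij//=; ring.
  rewrite (single j)//= ?ij ?jk ?eqxx//= ?andbF/=.
  by ring.
rewrite (single i)//= ?ij ?ik ?il ?eqxx//=.
by ring.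
Qed.

Definition quadratic_form (a : I * I -> R) w :=
  \sum_p a p * (Z p.1 w * Z p.2 w).

Let quadratic_formM a w : quadratic_form a w ^+ 2 =
  \sum_p \sum_p' a p * a p' * \prod_(n <- [:: p.1; p.2; p'.1; p'.2]) Z n w.
Proof.
rewrite /quadratic_form expr2 big_distrlr/=.
apply: eq_bigr => p _; apply: eq_bigr => p' _.
by rewrite !big_cons big_nil; ring.
Qed.

Lemma integrable_quadratic_form a :
  P.-integrable setT (fun w => (quadratic_form a w)%:E).
Proof.
rewrite /quadratic_form; under eq_fun do rewrite -sumEFin.
apply: integrable_sum => // p _; apply: integrable_scale.
have := @integrable_monomial [:: p.1; p.2] isT.
by apply: eq_integrable => // w _; rewrite /= !big_cons big_nil mulr1.
Qed.

Lemma integrable_quadratic_form_sqr a :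
  P.-integrable setT (fun w => (quadratic_form a w ^+ 2)%:E).
Proof.
under eq_fun do rewrite quadratic_formM -sumEFin.
apply: integrable_sum => // p _; under eq_fun do rewrite -sumEFin.
apply: integrable_sum => // p' _; apply: integrable_scale.
exact: integrable_monomial.
Qed.

Lemma Rintegral_quadratic_form a :
  \int[P]_w quadratic_form a w = v * \sum_i a (i, i).
Proof.
have int2 (p : I * I) : P.-integrable setT (fun w => (Z p.1 w * Z p.2 w)%:E).
  have := @integrable_monomial [:: p.1; p.2] isT.
  by apply: eq_integrable => // w _; rewrite /= !big_cons big_nil mulr1.
rewrite /quadratic_form Rintegral_sum; last first.
  by move=> p; exact: integrable_scale.
transitivity (\sum_p a p * (v * (p.1 == p.2)%:R)).
  apply: eq_bigr => p _; rewrite RintegralZl//; last exact: int2.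
  by congr (_ * _); exact: Rintegral_monomial2.
transitivity (\sum_i \sum_j a (i, j) * (v * (i == j)%:R)).
  by rewrite pair_bigA/=; apply: eq_bigr => -[].
rewrite mulr_sumr.
apply: eq_bigr => i _; rewrite (bigD1 i)//= eqxx big1 => [|j ji].
  by rewrite mulr1 addr0 mulrC.
by rewrite eq_sym (negbTE ji) mulr0n !mulr0.
Qed.

(** Of the three pairings of the indices in a (i, j) * a (k, l), the one inside
    the two factors gives the square of the trace, and the two others give the
    sums of a (i, j) * a (i, j) and of a (i, j) * a (j, i). *)
Lemma Rintegral_quadratic_form_sqr a :
  \int[P]_w (quadratic_form a w ^+ 2) =
  v ^+ 2 * ((\sum_i a (i, i)) ^+ 2
    + \sum_i \sum_j (a (i, j) ^+ 2 + a (i, j) * a (j, i)))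
  + (q - 3 * v ^+ 2) * \sum_i a (i, i) ^+ 2.
Proof.
have int4 (p p' : I * I) : P.-integrable setT
    (fun w => (\prod_(n <- [:: p.1; p.2; p'.1; p'.2]) Z n w)%:E).
  exact: integrable_monomial.
under eq_Rintegral do rewrite quadratic_formM.
rewrite Rintegral_sum; last first.
  move=> p; under eq_fun do rewrite -sumEFin.
  by apply: integrable_sum => // p' _; exact: integrable_scale.
have diag (F : I * I -> R) : \sum_p F p * (p.1 == p.2)%:R = \sum_i F (i, i).
  transitivity (\sum_i \sum_j F (i, j) * (i == j)%:R).
    by rewrite pair_bigA/=; apply: eq_bigr => -[].
  apply: eq_bigr => i _; rewrite (bigD1 i)//= eqxx mulr1 big1 ?addr0// => j ji.
  by rewrite eq_sym (negbTE ji) mulr0.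
have delta (F : I * I -> R) p : \sum_p' F p' * (p' == p)%:R = F p.
  rewrite (bigD1 p)//= eqxx mulr1 big1 ?addr0// => p' /negbTE ->.
  by rewrite mulr0.
transitivity (\sum_p \sum_p' (v ^+ 2 *
    ((a p * (p.1 == p.2)%:R) * (a p' * (p'.1 == p'.2)%:R)
     + a p * (a p' * (p' == p)%:R) + a p * (a p' * (p' == (p.2, p.1))%:R))
    + (q - 3 * v ^+ 2) *
      ((a p * (p.1 == p.2)%:R) * (a p' * (p' == p)%:R)))).
  apply: eq_bigr => p _.
  rewrite Rintegral_sum; last by move=> p'; exact: integrable_scale.
  apply: eq_bigr => p' _; rewrite RintegralZl//; last exact: int4.
  under eq_Rintegral do rewrite !big_cons big_nil mulr1 mulrA.
  rewrite [X in _ * X]Rintegral_monomial4.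
  case: p p' => [i j] [k l] /=; rewrite !xpair_eqE.
  rewrite (eq_sym k i) (eq_sym l j) (eq_sym k j) (eq_sym l i).
  rewrite [(j == k) && _]andbC.
  rewrite -!mulnb !natrM.
  have -> : (i == j)%:R * ((i == k)%:R * (i == l)%:R) =
      (i == j)%:R * ((i == k)%:R * (j == l)%:R) :> R.
    by have [->//|_] := eqVneq i j; rewrite !mul0r.
  by ring.
under eq_bigr => p _.
  rewrite big_split/= -!mulr_sumr !big_split/= -!mulr_sumr !delta diag.
  over.
rewrite big_split/= -!mulr_sumr !big_split/= -!mulr_suml diag.
rewrite pair_bigA/=.
have -> : \sum_p a p * (p.1 == p.2)%:R * a p = \sum_i a (i, i) ^+ 2.
  under eq_bigr do rewrite mulrAC.
  by rewrite diag; apply: eq_bigr => i _; rewrite expr2.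
rewrite !big_split/= -addrA expr2; congr (_ * (_ + (_ + _)) + _).
  by apply: eq_bigr => -[i j] _; rewrite /= expr2.
by apply: eq_bigr => -[i j].
Qed.

End centered_moments.

(** * Random variables with the same law *)

Section same_law.
Context (R : realType) d (T : measurableType d) (P : probability T R).
Context (X Y : {RV P >-> R}).
Hypothesis XY : forall B : set R, measurable B ->
  distribution P X B = distribution P Y B.
Context (h : R -> R).
Hypothesis mh : measurable_fun setT h.
Hypothesis ih : P.-integrable setT (fun w => (h (Y w))%:E).

Let mhE : measurable_fun setT (fun x => (h x)%:E).
Proof. exact/measurable_EFinP. Qed.

Lemma integrable_same_law : P.-integrable setT (fun w => (h (X w))%:E).
Proof.
apply/integrableP; split.
  by apply/measurable_EFinP; exact: measurableT_comp.
have mah : measurable_fun setT (fun x => `|(h x)%:E|%E).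
  exact: measurableT_comp.
rewrite -(ge0_integral_distribution X mah)//.
rewrite (eq_measure_integral (distribution P Y)); last first.
  by move=> B mB _; exact: XY.
rewrite (ge0_integral_distribution Y mah)//.
by have /integrableP[] := ih.
Qed.

Lemma Rintegral_same_law : \int[P]_w h (X w) = \int[P]_w h (Y w).
Proof.
congr fine.
rewrite -(integral_distribution mhE integrable_same_law).
rewrite -(integral_distribution mhE ih).
by apply: eq_measure_integral => B mB _; exact: XY.
Qed.

End same_law.

(** * One-sided deviations *)

(** Cantelli's inequality for the opposite variable. *)
Lemma cantelli_lower_tail (R : realType) d (T : measurableType d)
    (P : probability T R) (X : {RV P >-> R}) (lambda : R) :
    (X : T -> R) \in Lfun P 2%:E -> 0 < lambda ->
  (P [set w | (X w <= fine 'E_P[X] - lambda)%R]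
   <= (fine 'V_P[X] / (fine 'V_P[X] + lambda ^+ 2))%:E)%E.
Proof.
move=> X2 lambda0.
have X1 : (X : T -> R) \in Lfun P 1.
  by apply: Lfun_subset12 X2 => //; exact: fin_num_measure.
have NX2 : (\- X : T -> R) \in Lfun P 2%:E by rewrite rpredN.
pose NX : {RV P >-> R} := (- X)%R.
have := @cantelli _ _ _ P NX lambda NX2 lambda0.
rewrite -(varianceN X2); apply: le_trans.
rewrite le_eqVlt; apply/orP; left; apply/eqP.
have ENX : ('E_P[NX] = - 'E_P[X])%E.
  rewrite -mulN1e -expectationZl//; congr expectation.
  by apply/funext => w; rewrite /= mulrN1.
have [e EX] : exists e, ('E_P[X] = e%:E)%E.
  by exists (fine 'E_P[X]%E); rewrite fineK// expectation_fin_num.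
congr (P _); apply/seteqP; split => w /=;
  rewrite ENX EX -EFinN -EFinB lee_fin fctE /=; lra.
Qed.

(** * The empirical variance as a quadratic form *)

Section empirical_variance_coefficients.
Context (R : realType) (N : nat).
Hypothesis N2 : (2 <= N)%N.

(** The matrix (N - 1)^-1 (1 - J / N), where J is the all-ones matrix: the
    orthogonal projection onto the vectors of sum zero, divided by its rank. *)
Definition empirical_coef (p : 'I_N * 'I_N) : R :=
  (N%:R - 1)^-1 * ((p.1 == p.2)%:R - N%:R^-1).

Let N0 : N%:R != 0 :> R.
Proof. by rewrite pnatr_eq0 -lt0n (leq_trans _ N2). Qed.

Let N1 : N%:R - 1 != 0 :> R.
Proof. by rewrite subr_eq0 pnatr_eq1 gtn_eqF. Qed.

(** The deviations from the sample mean do not change when the same constant m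
    is subtracted from every observation. *)
Lemma empirical_varianceE (T : Type) (X : 'I_N -> T -> R) (m : R) w :
  empirical_variance X w =
  \sum_p empirical_coef p * ((X p.1 w - m) * (X p.2 w - m)).
Proof.
pose z i := X i w - m.
pose M := \sum_i z i.
have zX j : X j w - sample_mean X w = z j - N%:R^-1 * M.
  rewrite /M /z /sample_mean sumrB sumr_const card_ord -mulr_natr.
  by field; rewrite N0.
transitivity ((N%:R - 1)^-1 * (\sum_i z i ^+ 2 - N%:R^-1 * M ^+ 2)).
  rewrite /empirical_variance; congr (_ * _).
  transitivity (\sum_j (z j ^+ 2 - 2 * N%:R^-1 * M * z j + (N%:R^-1 * M) ^+ 2)).
    by apply: eq_bigr => j _; rewrite zX; ring.
  rewrite big_split/= sumrB -mulr_sumr -/M sumr_const card_ord -mulr_natr.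
  by field; rewrite N0.
rewrite (expr2 M) /M big_distrlr/= pair_bigA/= mulr_sumr.
transitivity ((N%:R - 1)^-1 * (\sum_p (p.1 == p.2)%:R * (z p.1 * z p.2)
    - \sum_p N%:R^-1 * (z p.1 * z p.2))).
  congr (_ * (_ - _)).
  transitivity (\sum_i \sum_j (i == j)%:R * (z i * z j)).
    apply: eq_bigr => i _; rewrite (bigD1 i)//= eqxx mul1r big1 ?addr0//.
    by move=> j; rewrite eq_sym => /negbTE ->; rewrite mul0r.
  by rewrite pair_bigA.
rewrite -sumrB mulr_sumr; apply: eq_bigr => p _.
by rewrite /empirical_coef /z; ring.
Qed.

Lemma sum_empirical_coef_diag : \sum_i empirical_coef (i, i) = 1.
Proof.
under eq_bigr do rewrite /empirical_coef/= eqxx mulr1n.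
by rewrite sumr_const card_ord -mulr_natr; field; rewrite N0 N1.
Qed.

Lemma sum_empirical_coef_diag_sqr :
  \sum_i empirical_coef (i, i) ^+ 2 = N%:R^-1.
Proof.
under eq_bigr do rewrite /empirical_coef/= eqxx mulr1n.
by rewrite sumr_const card_ord -mulr_natr; field; rewrite N0 N1.
Qed.

Lemma sum_empirical_coef_sqr :
  \sum_i \sum_j (empirical_coef (i, j) ^+ 2
    + empirical_coef (i, j) * empirical_coef (j, i)) = 2 / (N%:R - 1).
Proof.
transitivity (\sum_(i < N) 2 * (N%:R - 1)^-1 / N%:R : R).
  apply: eq_bigr => i _.
  transitivity (\sum_(j < N) 2 * (N%:R - 1)^-2 *
    ((1 - 2 / N%:R) * (j == i)%:R + N%:R^-1 ^+ 2) : R).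
    apply: eq_bigr => j _; rewrite /empirical_coef/= [i == j]eq_sym.
    by case: (j == i); rewrite /=; field; rewrite N0 N1.
  rewrite -mulr_sumr big_split/= -mulr_sumr sumr_const card_ord -mulr_natr.
  rewrite (bigD1 i)//= eqxx mulr1n big1 => [|j /negbTE->//].
  by field; rewrite N0 N1.
by rewrite sumr_const card_ord -mulr_natr; field; rewrite N0 N1.
Qed.

End empirical_variance_coefficients.

(** * Integrability of powers *)

Section Lfun_facts.
Context (R : realType) d (T : measurableType d) (P : probability T R).

Lemma sqr_integrable_Lfun2 (f : T -> R) : measurable_fun setT f ->
    P.-integrable setT (fun w => (f w ^+ 2)%:E) ->
  f \in Lfun P 2%:E.
Proof.
move=> mf /integrableP[_ f2oo]; rewrite inE; apply/andP; split; rewrite inE//=.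
rewrite /finite_norm unlock /Lnorm; apply: poweR_lty.
apply: le_lt_trans f2oo; rewrite le_eqVlt; apply/orP; left; apply/eqP.
apply: eq_integral => w _ /=.
by rewrite powR_mulrn// real_normK ?num_real// ger0_norm ?sqr_ge0.
Qed.

Lemma integrable_centered_pow (f : T -> R) (m : R) (k : nat) :
    f \in Lfun P 4%:E -> (k <= 4)%N ->
  P.-integrable setT (fun w => ((f w - m) ^+ k)%:E).
Proof.
move=> f4; case: k => [|k] k4.
  under eq_fun do rewrite expr0.
  exact: (finite_measure_integrable_cst P 1 measurableT).
have Pfin : P setT \is a fin_num by exact: fin_num_measure.
have g4 : (f \- cst m)%R \in Lfun P 4%:E.
  by rewrite rpredB ?lee1n//= => _; rewrite Lfun_cst.
have k1 : (1 <= k.+1%:R%:E :> \bar R)%E by rewrite lee_fin ler1n.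
have gk : (f \- cst m)%R \in Lfun P k.+1%:R%:E.
  by apply: (Lfun_subset k1 _ Pfin _ g4) => [|];
    rewrite lee_fin ?ler1n ?ler_nat.
have := Lfun_integrable _ gk; rewrite ler1n => /(_ isT).
apply: le_integrable => //.
  apply/measurable_EFinP; apply: measurable_funX.
  by move: gk; rewrite inE => /andP[]; rewrite inE.
move=> w _; rewrite powR_mulrn// /= lee_fin normrX [leRHS]ger0_norm//.
Qed.

End Lfun_facts.

(** * Mean and variance of the empirical variance *)

Definition central_moment (R : realType) d (T : measurableType d)
    (P : probability T R) (X : {RV P >-> R}) (k : nat) : R :=
  \int[P]_w ((X w - fine 'E_P[X]%E) ^+ k).

Section empirical_variance_moments.
Context (R : realType) d (T : measurableType d) (P : probability T R).
Context (Q : {RV P >-> R}) (N : nat) (X : 'I_N -> {RV P >-> R}).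
Hypothesis Q4 : (Q : T -> R) \in Lfun P 4%:E.
Hypothesis N2 : (2 <= N)%N.
Hypothesis iidX : iid_samples Q X.

Local Notation m := (fine 'E_P[Q]%E).
Local Notation v := (central_moment Q 2).
Local Notation q := (central_moment Q 4).

Let iQ k : (k <= 4)%N -> P.-integrable setT (fun w => ((Q w - m) ^+ k)%:E).
Proof. exact: integrable_centered_pow. Qed.

Let pow k (x : R) := (x - m) ^+ k.

Let measurable_pow k : measurable_fun setT (pow k).
Proof. by apply: measurable_funX; exact: measurable_funB. Qed.

Let iX i k : (k <= 4)%N -> P.-integrable setT (fun w => ((X i w - m) ^+ k)%:E).
Proof.
move=> k4; apply: (integrable_same_law (iidX.2 i) (measurable_pow k)).
exact: iQ.
Qed.

Let EXQ i k : (k <= 4)%N ->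
  \int[P]_w ((X i w - m) ^+ k) = \int[P]_w ((Q w - m) ^+ k).
Proof.
move=> k4; apply: (Rintegral_same_law (iidX.2 i) (measurable_pow k)).
exact: iQ.
Qed.

Lemma fine_variance_centered : fine 'V_P[Q]%E = v.
Proof.
rewrite /variance unlock /central_moment; set m' := fine 'E_P[Q]%E.
rewrite unlock.
by congr fine; apply: eq_integral => w _; rewrite expr2.
Qed.

Lemma kurtosis_centered : kurtosis Q = q / v ^+ 2.
Proof.
rewrite /kurtosis fine_variance_centered; congr (_ / _).
rewrite /central_moment; set m' := fine 'E_P[Q]%E; rewrite unlock.
congr fine; apply: eq_integral => w _.
by rewrite -[4%N]/(2 * 2)%N exprM real_normK ?num_real// -exprM.
Qed.

Let EX1 i : \int[P]_w (X i w - m) = 0.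
Proof.
rewrite [LHS](EXQ i (k := 1))//.
under eq_Rintegral do rewrite expr1.
have iQ1 : P.-integrable setT (EFin \o Q).
  apply/Lfun1_integrable; apply: (Lfun_subset _ _ _ _ Q4) => //.
  - by rewrite lee_fin ler1n.
  - exact: fin_num_measure.
  - by rewrite lee_fin ler1n.
rewrite RintegralB//; last exact: finite_measure_integrable_cst.
rewrite [X in _ - X]Rintegral_probability_cst.
by rewrite unlock subrr.
Qed.

Let EX2 i : \int[P]_w ((X i w - m) ^+ 2) = v. Proof. exact: EXQ. Qed.
Let EX4 i : \int[P]_w ((X i w - m) ^+ 4) = q. Proof. exact: EXQ. Qed.

Let iS := integrable_quadratic_form (iidX.1) iX (@empirical_coef R N).
Let iSS := integrable_quadratic_form_sqr (iidX.1) iX (@empirical_coef R N).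

Let SE : quadratic_form X m (@empirical_coef R N) = empirical_variance X.
Proof. by apply/funext => w; rewrite (empirical_varianceE N2 _ m). Qed.

Lemma measurable_empirical_variance :
  measurable_fun setT (empirical_variance X : T -> R).
Proof. by rewrite -SE; apply/measurable_EFinP; have /integrableP[] := iS. Qed.

Lemma empirical_variance_Lfun2 :
  (empirical_variance X : T -> R) \in Lfun P 2%:E.
Proof.
apply: sqr_integrable_Lfun2; first exact: measurable_empirical_variance.
by rewrite -SE.
Qed.

Lemma expectation_empirical_variance :
  fine 'E_P[empirical_variance X]%E = v.
Proof.
rewrite unlock -SE -[LHS]/(\int[P]_w quadratic_form X m _ w).
rewrite (Rintegral_quadratic_form iidX.1 iX EX1 EX2).
by rewrite sum_empirical_coef_diag ?mulr1.
Qed.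

(** The variance of a quadratic form with symmetric matrix a is
    2 v ^+ 2 tr (a ^+ 2) + (q - 3 v ^+ 2) times the sum of the squared diagonal
    entries; here tr (a ^+ 2) = (N - 1)^-1 and that sum is N^-1. *)
Lemma variance_empirical_variance :
  fine 'V_P[empirical_variance X]%E =
  N%:R^-1 * (q - v ^+ 2 * ((N%:R - 3) / (N%:R - 1))).
Proof.
have S2 := empirical_variance_Lfun2.
have S1 : (empirical_variance X : T -> R) \in Lfun P 1.
  by apply: Lfun_subset12 S2 => //; exact: fin_num_measure.
have ES : ('E_P[empirical_variance X] = v%:E)%E.
  by rewrite -expectation_empirical_variance fineK// expectation_fin_num.
rewrite varianceE// ES -EFin_expe fineB//=; last first.
  by rewrite unlock -SE; exact: integrable_fin_num.
rewrite unlock -SE -[X in X - _]/(\int[P]_w (quadratic_form X m _ w ^+ 2)).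
rewrite (Rintegral_quadratic_form_sqr iidX.1 iX EX1 EX2 EX4).
rewrite sum_empirical_coef_diag// sum_empirical_coef_sqr//.
rewrite sum_empirical_coef_diag_sqr//.
have N0 : N%:R != 0 :> R by rewrite pnatr_eq0 -lt0n (leq_trans _ N2).
have N1 : N%:R - 1 != 0 :> R by rewrite subr_eq0 pnatr_eq1 gtn_eqF.
by field; rewrite N0 N1.
Qed.

(** The variable (Q - 'E[Q]) ^+ 2 has the nonnegative variance q - v ^+ 2. *)
Lemma sqr_variance_le_fourth_moment : v ^+ 2 <= q.
Proof.
have i4 := iQ (k := 4) isT; have i2 := iQ (k := 2) isT.
have icst : P.-integrable setT (EFin \o cst (v ^+ 2)).
  exact: finite_measure_integrable_cst.
have i2' := integrable_scale (- (2 * v)) i2.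
have expand : \int[P]_w (((Q w - m) ^+ 2 - v) ^+ 2) =
    q + (- (2 * v) * v + v ^+ 2).
  transitivity (\int[P]_w ((Q w - m) ^+ 4
      + (- (2 * v) * (Q w - m) ^+ 2 + v ^+ 2))).
    by apply: eq_Rintegral => w _; ring.
  rewrite RintegralD//; last exact: (integrableD measurableT i2' icst).
  rewrite RintegralD// RintegralZl//.
  by rewrite [X in _ + (_ + X)]Rintegral_probability_cst.
have : 0 <= \int[P]_w (((Q w - m) ^+ 2 - v) ^+ 2).
  by apply: Rintegral_ge0 => w _; exact: sqr_ge0.
by rewrite expand; nra.
Qed.

End empirical_variance_moments.

(** * The probability of underestimating the variance *)

Theorem mainTheorem4 (R : realType) (n : nat)
    (d : measure_display) (Omega : measurableType d) (P : probability Omega R)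
    (Y : {RV P >-> n.-tuple R})
    (Y_uniform : uniform_on (unit_cube R n) Y)
    (f : n.-tuple R -> R) (f_measurable : measurable_fun setT f)
    (S : set (n.-tuple R)) (S_measurable : measurable S)
    (S_cube : S `<=` unit_cube R n)
    (S_pos : (0 < lebesgue_measure_tuple R n S)%E)
    (d' : measure_display) (Omega' : measurableType d')
    (P' : probability Omega' R)
    (Q : {RV P' >-> R}) (Q_law : has_cond_distribution Y f S Q)
    (Q_moment4 : (Q : Omega' -> R) \in Lfun P' 4%:E)
    (N : nat) (N_ge2 : (2 <= N)%N)
    (X : 'I_N -> {RV P' >-> R}) (X_iid : iid_samples Q X)
    (var_pos : (0 < 'V_P'[Q])%E)
    (theta : R) (theta01 : 0 <= theta <= 1) :
  let sigma2 := fine 'V_P'[Q] in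
  let c := kurtosis Q - (N%:R - 3) / (N%:R - 1) in
  (P' [set w | (empirical_variance X w <= theta * sigma2)%R]
    <= (1 - (1 - theta) ^+ 2 / ((1 - theta) ^+ 2 + N%:R^-1 * c))%:E)%E
  /\ 1 - (1 - theta) ^+ 2 / ((1 - theta) ^+ 2 + N%:R^-1 * c)
     = c / (N%:R * (1 - theta) ^+ 2 + c).
Proof.
move=> sigma2 c.
have Q2 : (Q : Omega' -> R) \in Lfun P' 2%:E.
  apply: (Lfun_subset _ _ _ _ Q_moment4).
  - exact: lee1n.
  - exact: lee1n.
  - exact: fin_num_measure.
  - by rewrite lee_fin ler_nat.
have sigma2_gt0 : 0 < sigma2.
  by rewrite fine_gt0// var_pos ltey_eq variance_fin_num.
have N0 : 0 < N%:R :> R by rewrite ltr0n (leq_trans _ N_ge2).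
have N1 : 0 < N%:R - 1 :> R by rewrite subr_gt0 ltr1n.
have c_gt0 : 0 < c.
  have kurt1 : 1 <= kurtosis Q.
    rewrite kurtosis_centered -fine_variance_centered.
    rewrite ler_pdivlMr ?exprn_gt0// mul1r fine_variance_centered.
    exact: sqr_variance_le_fourth_moment.
  by rewrite /c subr_gt0 (lt_le_trans _ kurt1)// ltr_pdivrMr//; lra.
have Nc : 0 < N%:R^-1 * c by rewrite mulr_gt0// invr_gt0.
have D1 : (1 - theta) ^+ 2 + N%:R^-1 * c != 0.
  by rewrite gt_eqF// ltr_wpDl// sqr_ge0.
have D2 : N%:R * (1 - theta) ^+ 2 + c != 0.
  by rewrite gt_eqF// ltr_wpDl// mulr_ge0 ?sqr_ge0// ltW.
split; last first.
  by field; rewrite D2 gt_eqF// D1.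
have mS := measurable_empirical_variance Q_moment4 N_ge2 X_iid.
(* Cantelli's inequality needs a positive deviation (1 - theta) * sigma2, but
   for theta = 1 the bound is 1. *)
have [->|theta1] := eqVneq theta 1.
  rewrite subrr expr0n/= mul0r subr0; apply: probability_le1.
  rewrite -[X in measurable X]setTI.
  rewrite (_ : [set w | _] = (empirical_variance X) @^-1` `]-oo, (1 * sigma2)]).
    by apply: mS.
  by apply/seteqP; split => w; rewrite /= in_itv.
have theta_lt1 : theta < 1 by rewrite lt_neqAle theta1; case/andP: theta01.
have lambda0 : 0 < (1 - theta) * sigma2 by rewrite mulr_gt0// subr_gt0.
pose mS_mixin := isMeasurableFun.Build _ _ _ _ _ mS.
pose S2 : {RV P' >-> R} :=
  HB.pack (empirical_variance X : Omega' -> R) mS_mixin.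
have := cantelli_lower_tail (X := S2)
  (empirical_variance_Lfun2 Q_moment4 N_ge2 X_iid) lambda0.
rewrite /= (expectation_empirical_variance Q_moment4 N_ge2 X_iid).
rewrite (variance_empirical_variance Q_moment4 N_ge2 X_iid).
rewrite -fine_variance_centered -/sigma2.
have -> : sigma2 - (1 - theta) * sigma2 = theta * sigma2 by ring.
have -> : central_moment Q 4 = sigma2 ^+ 2 * (c + (N%:R - 3) / (N%:R - 1)).
  rewrite /c kurtosis_centered -fine_variance_centered subrK -/sigma2.
  by rewrite mulrC divfK// gt_eqF// exprn_gt0.
move=> /le_trans; apply; rewrite lee_fin le_eqVlt; apply/orP; left; apply/eqP.
have s0 : sigma2 != 0 by rewrite gt_eqF.
rewrite -mulrBr addrK mulrCA exprMn [_ * sigma2 ^+ 2]mulrC -mulrDr.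
rewrite -mulf_div divff ?expf_neq0// mul1r [_ + (1 - theta) ^+ 2]addrC.
by move: D1; set x := N%:R^-1 * c => D1; field.
Qed.
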